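(* If $s\geq 2$ and $t\geq 2$ are integers, then $\mathrm{oh}(K_s\square K_t)\geq s+t-2$.
   Context: $\mathrm{oh}(G)$ (Odd Hadwiger number) of a finite simple graph $G$ is the largest integer $m$ for which there exist $m$ pairwise vertex-disjoint trees $Z_1,\dots,Z_m$ in $G$ and a 2-colouring $c$ of $V(Z_1)\cup\dots\cup V(Z_m)$ that is proper on each $Z_k$, such that for every $k\neq k'$ there is an edge $xy\in E(G)$ with $x\in V(Z_k)$, $y\in V(Z_{k'})$, $c(x)=c(y)$. The Cartesian product $G\square H$ has vertex set $V(G)\times V(H)$, with $(v_1,u_1)\sim(v_2,u_2)$ iff ($v_1=v_2$ and $u_1u_2\in E(H)$) or ($u_1=u_2$ and $v_1v_2\in E(G)$). *)

(* Defs.v *)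
From mathcomp Require Import all_boot.
From mathcomp Require Import boolp.

Set Implicit Arguments.
Unset Strict Implicit.
Unset Printing Implicit Defensive.

Record sgraph := SGraph {
  vertex :> finType;
  edge : rel vertex;
  edge_sym : symmetric edge;
  edge_irr : irreflexive edge }.

(* Subgraphs need not be induced. *)
Record subgraph (G : sgraph) := Subgraph {
  sub_verts : {set G};
  sub_edge : rel G;
  sub_edge_sym : symmetric sub_edge;
  sub_edge_sub : subrel sub_edge (@edge G);
  sub_edge_verts : forall x y, sub_edge x y ->
    x \in sub_verts /\ y \in sub_verts }.

Definition sub_connected (G : sgraph) (Z : subgraph G) : Prop :=
  sub_verts Z != set0 /\
  {in sub_verts Z &, forall x y, connect (sub_edge Z) x y}.

(* [ucycle] also accepts the empty sequence and, as [sub_edge] is symmetric,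
   the sequence [:: x; y] for each edge xy; cycles have at least 3 vertices. *)
Definition sub_acyclic (G : sgraph) (Z : subgraph G) : Prop :=
  forall p : seq G, ucycle (sub_edge Z) p -> size p < 3.

Definition is_tree (G : sgraph) (Z : subgraph G) : Prop :=
  sub_connected Z /\ sub_acyclic Z.

(* The colouring is total on G, but only its values on the trees matter. *)
Definition odd_expansion (G : sgraph) (m : nat)
    (Z : 'I_m -> subgraph G) (c : G -> bool) : Prop :=
  [/\ forall k, is_tree (Z k),
      forall k k', k != k' -> [disjoint sub_verts (Z k) & sub_verts (Z k')],
      forall k x y, sub_edge (Z k) x y -> c x != c y &
      forall k k', k != k' -> exists x y,
        [/\ x \in sub_verts (Z k), y \in sub_verts (Z k'),
            edge x y & c x = c y] ].

Definition has_odd_minor (G : sgraph) (m : nat) : Prop :=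
  exists (Z : 'I_m -> subgraph G) (c : G -> bool), odd_expansion Z c.

Lemma has_odd_minor0 (G : sgraph) : exists m, `[< has_odd_minor G m >].
Proof.
exists 0; apply/asboolP.
by exists (fun k : 'I_0 => match notF (ltn_ord k) with end), (fun=> true);
  split; case.
Qed.

Lemma has_odd_minor_bound (G : sgraph) (m : nat) :
  `[< has_odd_minor G m >] -> m <= #|G|.
Proof.
move=> /asboolP [Z [c [treeZ disjZ _ _]]].
have rep k : exists x, x \in sub_verts (Z k).
  by case: (treeZ k) => [[/set0Pn]].
pose f k := xchoose (rep k).
have fZ k : f k \in sub_verts (Z k) := xchooseP (rep k).
rewrite -[m]card_ord; apply: (@leq_card _ _ f) => k k' eqf.
apply/eqP/negPn/negP => /disjZ /disjointFr /(_ (fZ k)).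
by rewrite eqf fZ.
Qed.

Definition oh (G : sgraph) : nat :=
  ex_maxn (has_odd_minor0 G) (@has_odd_minor_bound G).

Lemma oh_spec (G : sgraph) :
  has_odd_minor G (oh G) /\ (forall m, has_odd_minor G m -> m <= oh G).
Proof.
rewrite /oh; case: ex_maxnP => m /asboolP Gm max_m.
by split=> // n /asboolP; apply: max_m.
Qed.

Definition complete_edge (n : nat) : rel 'I_n := fun i j => i != j.

Lemma complete_edge_sym n : symmetric (@complete_edge n).
Proof. by move=> i j; rewrite /complete_edge eq_sym. Qed.

Lemma complete_edge_irr n : irreflexive (@complete_edge n).
Proof. by move=> i; rewrite /complete_edge eqxx. Qed.

Definition complete_graph (n : nat) : sgraph :=
  SGraph (@complete_edge_sym n) (@complete_edge_irr n).

Definition cart_edge (G H : sgraph) : rel (G * H)%type := fun p q =>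
  ((p.1 == q.1) && edge p.2 q.2) || ((p.2 == q.2) && edge p.1 q.1).

Lemma cart_edge_sym (G H : sgraph) : symmetric (@cart_edge G H).
Proof.
move=> p q; rewrite /cart_edge [p.1 == _]eq_sym [p.2 == _]eq_sym.
by rewrite [edge p.1 _]edge_sym [edge p.2 _]edge_sym.
Qed.

Lemma cart_edge_irr (G H : sgraph) : irreflexive (@cart_edge G H).
Proof. by move=> p; rewrite /cart_edge !edge_irr !andbF. Qed.

Definition cart_prod (G H : sgraph) : sgraph :=
  SGraph (@cart_edge_sym G H) (@cart_edge_irr G H).

(* Main.v *)
Require Import Defs.
From mathcomp Require Import all_boot.

(** Number the rows 0, ..., s-1 and the columns 0, ..., t-1, and colour a vertex
    according to whether it lies in column 0.  The expansion consists of the t-1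
    single vertices of row 0 outside column 0 and, for each of the s-1 other
    rows, of the star spanning that row with its centre in column 0.  Any two of
    these trees contain vertices outside column 0 that are adjacent. *)

Set Implicit Arguments.
Unset Strict Implicit.
Unset Printing Implicit Defensive.

Section Star.

Variables (G : sgraph) (a : G) (L : {set G}).
Hypothesis adjL : {in L, forall x, edge a x}.

Definition star_edge : rel G :=
  fun x y => (x == a) && (y \in L) || (y == a) && (x \in L).

Lemma star_edge_sym : symmetric star_edge.
Proof. by move=> x y; rewrite /star_edge orbC. Qed.

Lemma star_edge_sub : subrel star_edge (@edge G).
Proof.
by move=> x y /orP[] /andP[/eqP-> /adjL] //; rewrite edge_sym.
Qed.

Lemma star_edge_verts x y : star_edge x y -> x \in a |: L /\ y \in a |: L.
Proof.
by rewrite !inE => /orP[] /andP[/eqP-> ->]; rewrite eqxx !orbT.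
Qed.

(** An empty [L] is allowed and gives the one-vertex tree on [a], so rows and single vertices share
    one construction. *)
Definition star : subgraph G :=
  Subgraph star_edge_sym star_edge_sub star_edge_verts.

Lemma star_edge_leaf x y : x != a -> star_edge x y -> y = a.
Proof. by move=> /negPf xa; rewrite /star_edge xa => /andP[/eqP]. Qed.

Lemma star_tree : is_tree star.
Proof.
split; first split.
- by apply/set0Pn; exists a; rewrite setU11.
- have ca x : x \in a |: L -> connect star_edge a x.
    rewrite in_setU1 => /orP[/eqP-> // | Lx]; apply: connect1.
    by rewrite /star_edge eqxx Lx.
  move=> x y /ca ax /ca; apply: connect_trans.
  by rewrite (sym_connect_sym star_edge_sym).
case=> [|x [|y [|z p]]] //=; rewrite /ucycle /= !inE !negb_or -!andbA.
case/and5P=> exy eyz ezp xy /andP[xz] /and3P[_ yz /andP[yp _]].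
(* On a cycle, a vertex other than [a] would have two distinct neighbours, both equal to [a]. This
   is applied to [y] if [y != a], and otherwise to [z], whose successor is the head of [p], or [x]
   when [p] is empty. *)
have [ya | ya] := eqVneq y a; last first.
  move: exy xz; rewrite star_edge_sym => /(star_edge_leaf ya) ->.
  by rewrite (star_edge_leaf ya eyz) eqxx.
have za : z != a by rewrite -ya eq_sym.
case: p ezp yp => [|w q] /= /andP[/(star_edge_leaf za) ezw _].
  by rewrite ezw ya eqxx in xy.
by rewrite ezw ya mem_head.
Qed.

End Star.

Section RookExpansion.

Variables m n : nat.

Let G := cart_prod (complete_graph m.+1) (complete_graph n.+1).

Lemma rook_edge_row i j j' : j != j' -> @edge G (i, j) (i, j').
Proof. by move=> jj'; apply/orP; left; apply/andP. Qed.

Lemma rook_edge_col i i' j : i != i' -> @edge G (i, j) (i', j).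
Proof. by move=> ii'; apply/orP; right; apply/andP. Qed.

(** [inl] indexes the rows other than row 0 and [inr] the columns other than column 0; [lift ord0]
    is the shift by one that skips index 0. *)
Definition rook_center (u : 'I_m + 'I_n) : G :=
  match u with
  | inl i => (lift ord0 i, ord0)
  | inr j => (ord0, lift ord0 j)
  end.

Definition rook_leaves (u : 'I_m + 'I_n) : {set G} :=
  if u is inl i then [set p : G | (p.1 == lift ord0 i) && (p.2 != ord0)]
  else set0.

Lemma rook_leaves_adj u : {in rook_leaves u, forall p, edge (rook_center u) p}.
Proof.
case: u => [i | j] [i' j']; rewrite !inE //= => /andP[/eqP-> j'0].
by apply: rook_edge_row; rewrite eq_sym.
Qed.

Definition rook_star u : subgraph G := star (@rook_leaves_adj u).

Definition rook_color (p : G) : bool := p.2 != ord0.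

(** Row indices separate any two trees except two single vertices, which both lie in row 0. *)
Lemma rook_star_row u p : p \in sub_verts (rook_star u) ->
  p.1 = (if u is inl i then lift ord0 i else ord0).
Proof.
by case: u => [i | j]; rewrite !inE ?orbF; [case/orP=> [|/andP[]]|] => /eqP->.
Qed.

Lemma rook_star_disjoint u v : u != v ->
  [disjoint sub_verts (rook_star u) & sub_verts (rook_star v)].
Proof.
move=> uv; apply/pred0P => p /=; apply/negP => /andP[pu pv].
have := rook_star_row pu; rewrite (rook_star_row pv).
case: u v uv pu pv => [i | j] [i' | j'] //= uv pu pv.
  by move=> /lift_inj ei; rewrite ei eqxx in uv.
move: pu pv uv; rewrite !inE !orbF => /eqP-> /eqP /(congr1 snd).
by move=> /lift_inj ->; rewrite eqxx.
Qed.

(** Every edge joins a centre in column 0 to a leaf outside it; the stars indexed by [inr] have no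
    edges. *)
Lemma rook_star_proper u p q :
  sub_edge (rook_star u) p q -> rook_color p != rook_color q.
Proof.
rewrite /rook_color /= /star_edge.
by case: u => [i | j] /orP[] /andP[/eqP->]; rewrite !inE //= ?eqxx;
  case/andP=> _ ->.
Qed.

Lemma rook_star_row_leaf i j :
  (lift ord0 i, lift ord0 j) \in sub_verts (rook_star (inl i)).
Proof. by rewrite !inE /= eqxx orbT. Qed.

Lemma rook_star_single j :
  (ord0, lift ord0 j) \in sub_verts (rook_star (inr j)).
Proof. exact: setU11. Qed.

Lemma rook_star_linked u v : 0 < n -> u != v -> exists p q,
  [/\ p \in sub_verts (rook_star u), q \in sub_verts (rook_star v),
      edge p q & rook_color p = rook_color q].
Proof.
move=> n_gt0; case: u v => [i | j] [i' | j'] uv.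
(* Two row stars are joined in column 1, which exists because [0 < n]. A row star and a single
   vertex are joined in the column of that vertex. *)
- exists (lift ord0 i, lift ord0 (Ordinal n_gt0)).
  exists (lift ord0 i', lift ord0 (Ordinal n_gt0)).
  split; [exact: rook_star_row_leaf | exact: rook_star_row_leaf | | by []].
  by apply: rook_edge_col; rewrite (inj_eq lift_inj).
- exists (lift ord0 i, lift ord0 j'), (ord0, lift ord0 j').
  split; [exact: rook_star_row_leaf | exact: rook_star_single | | by []].
  exact: rook_edge_col.
- exists (ord0, lift ord0 j), (lift ord0 i', lift ord0 j).
  split; [exact: rook_star_single | exact: rook_star_row_leaf | | by []].
  exact: rook_edge_col.
- exists (ord0, lift ord0 j), (ord0, lift ord0 j').
  split; [exact: rook_star_single | exact: rook_star_single | | by []].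
  by apply: rook_edge_row; rewrite (inj_eq lift_inj).
Qed.

Lemma rook_odd_minor : 0 < n -> has_odd_minor G (m + n).
Proof.
move=> n_gt0; exists (fun k => rook_star (split k)), rook_color.
(* [split] is injective, so distinct indices select distinct stars. *)
have split_neq (k k' : 'I_(m + n)) : k != k' -> split k != split k'.
  by rewrite (inj_eq (can_inj (@splitK m n))).
split=> [k | k k' /split_neq | k p q | k k' /split_neq].
- exact: star_tree.
- exact: rook_star_disjoint.
- exact: rook_star_proper.
- exact: rook_star_linked.
Qed.

End RookExpansion.

Theorem theorem8 (s t : nat) (hs : 2 <= s) (ht : 2 <= t) :
  s + t - 2 <= oh (cart_prod (complete_graph s) (complete_graph t)).
Proof.
(* With [s = m.+1] and [t = n.+1] the bound becomes [m + n], and [2 <= t] becomes [0 < n]. *)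
case: s t hs ht => [|m] [|n] // _ n_gt0; rewrite addSn addnS subn2 /=.
by have [_] := oh_spec (cart_prod (complete_graph m.+1) (complete_graph n.+1));
  apply; exact: rook_odd_minor.
Qed.
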